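(* Let $n\in\mathbb{N}$, $T>0$, and for each $i\in\{1,\dots,n\}$ let $\alpha_i\in(0,1)$ and let $\tilde g_i:[0,\infty)\to\mathbb{R}$ be a continuous $T$-periodic function. Suppose that for every $p\in\mathbb{N}$ and every $i\in\{1,\dots,n\}$ $$\int_0^{pT}(pT-\tau)^{\alpha_i-1}\,\tilde g_i(\tau)\,d\tau=0 .$$ Then for every $m\in\mathbb{N}$ and every $i\in\{1,\dots,n\}$ $$\int_0^T \tau^m\,\tilde g_i(\tau)\,d\tau=0 .$$
   Context: $\mathbb{N}$ denotes the set of positive integers. The setting is a time-invariant fractional order system with $n$ state components and fractional orders $\alpha_i\in(0,1)$. The function $\tilde g_i$ is the $i$-th component of the system's right-hand side evaluated along a hypothetical periodic solution of period $T$, so it is itself $T$-periodic. Since $0<\alpha_i<1$, the kernel $(pT-\tau)^{\alpha_i-1}$ has an integrable singularity at $\tau=pT$; the integrals are convergent (Lebesgue or improper Riemann) integrals. *)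

(* Defs.v *)
From HB Require Import structures.
From mathcomp Require Import all_boot all_order all_algebra.
From mathcomp Require Import all_classical all_reals all_analysis.
Import Order.TTheory GRing.Theory Num.Theory.
Import numFieldNormedType.Exports.

Set Implicit Arguments.
Unset Strict Implicit.
Unset Printing Implicit Defensive.

Local Open Scope classical_set_scope.
Local Open Scope ring_scope.

(* A function on [0, +oo[ is represented by a total function R -> R of which
   only the values on [0, +oo[ are constrained. *)

Definition continuous_half_line (R : realType) (f : R -> R) : Prop :=
  {within [set` `[0, +oo[%R], continuous f}.

Definition periodic_half_line (R : realType) (T : R) (f : R -> R) : Prop :=
  forall t : R, 0 <= t -> f (t + T) = f t.

(* Main.v *)
Require Import Defs.
From HB Require Import structures.
From mathcomp Require Import all_boot all_order all_algebra.
From mathcomp Require Import all_classical all_reals all_analysis.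
From mathcomp Require Import measurable_realfun ring lra.
Import Order.TTheory GRing.Theory Num.Theory.
Import numFieldNormedType.Exports.

Local Open Scope classical_set_scope.
Local Open Scope ring_scope.

(** Fix a component, put b = alpha - 1 < 0, and let N >= 2 be an integer. By
periodicity and the substitution t -> t + T, the part over T <= t <= N T of the
integral for p = N is the whole integral for p = N - 1, which is zero. So the
part over the first period vanishes too ([integral_powR_first_period]), and
after division by (N T)^b the integral of (1 - t / (N T))^b g(t) over 0 <= t <= T
is zero for every N >= 2.

Expanding the kernel in powers of 1/N makes this integral a power series in 1/N
whose K-th coefficient is a nonzero constant times the moment of order K of g.
It vanishes at points accumulating at 0, so all its coefficients vanish. In
finite terms, replace (1 - u)^b by a Taylor polynomial of degree exactly K, with
error O(u^(K+1)) ([powR_taylor]), and argue by induction on K: once the moments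
of order less than K are zero, the one of order K is O(1/N)
([Rintegral_poly_eq0]). The degree is exactly K because b < 0 makes every
coefficient of the binomial series nonzero.

The singular integrals are cut at T and not at their singularity: on the first
piece the kernel is bounded, and the second piece is known to be zero. *)

(** * Translation of Lebesgue integrals *)

Lemma lebesgue_measure_translation (R : realType) (c : R) (A : set R) :
  measurable A ->
  pushforward (@lebesgue_measure R)
    ((fun x => x + c) : measurableTypeR R -> measurableTypeR R) A =
  lebesgue_measure A.
Proof.
move=> mA.
apply/esym/lebesgue_measure_unique => //= [|_ _ [[a b]] _ <-].
  by apply: measurable_funD => //; exact: measurable_cst.
rewrite /pushforward.
have -> : (fun x => x + c) @^-1` `]a, b]%classic = `]a - c, b - c]%classic.
  by apply/seteqP; split => x /=; rewrite !in_itv/= ltrBlDr lerBrDr.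
rewrite !lebesgue_measure_itv/= !lte_fin ltrD2r; case: ifP => // _.
by rewrite -!EFinB; congr EFin; lra.
Qed.

(** The positive and negative parts are translated separately, so that the
identity also covers divergent integrals. *)
Lemma integral_translation (R : realType) (c : R) (D : set R)
    (f : R -> \bar R) : measurable D -> measurable_fun D f ->
  (\int[@lebesgue_measure R]_(x in D) f x =
   \int[@lebesgue_measure R]_(x in (fun x => x + c)%R @^-1` D) f (x + c)%R)%E.
Proof.
move=> mD mf.
have mc : measurable_fun setT
    ((fun x => x + c) : measurableTypeR R -> measurableTypeR R).
  by apply: measurable_funD => //; exact: measurable_cst.
have ge0 h : measurable_fun D h -> (forall x, 0 <= h x)%E ->
  (\int[@lebesgue_measure R]_(x in D) h x =
   \int[@lebesgue_measure R]_(x in (fun x => x + c)%R @^-1` D) h (x + c)%R)%E.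
  move=> mh h0; rewrite -(ge0_integral_pushforward mc)//.
  apply: eq_measure_integral => A mA _.
  exact/esym/lebesgue_measure_translation.
rewrite integralE [RHS]integralE; congr (_ - _)%E.
- rewrite (ge0 (f^\+)%E)//; last exact: measurable_funepos.
  by apply: eq_integral => x _; rewrite !funeposE.
- rewrite (ge0 (f^\-)%E)//; last exact: measurable_funeneg.
  by apply: eq_integral => x _; rewrite !funenegE.
Qed.

(** * Taylor expansion of the kernel *)

Lemma is_derive_powR_subr (R : realType) (b u : R) : u < 1 ->
  is_derive u 1 (fun v : R => (1 - v) `^ b) (- b * (1 - u) `^ (b - 1)).
Proof.
move=> u1.
have d1 : is_derive u 1 (fun v : R => 1 - v) (-1).
  by apply: is_derive_eq; rewrite add0r mul1r.
have d2 : is_derive (1 - u) 1 (fun v : R => v `^ b) (b * (1 - u) `^ (b - 1)).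
  by apply: is_derive1_powR; rewrite subr_gt0.
have := @is_derive1_comp _ (fun v : R => v `^ b) (fun v : R => 1 - v)
  _ _ _ d2 d1.
by move=> /is_derive_eq; apply; rewrite mulrN1 mulNr.
Qed.

(** Induction on [K] for all negative exponents at once: the derivative of
[(1 - u) ^ b] is [- b * (1 - u) ^ (b - 1)], so an expansion for the exponent
[b - 1] is integrated to one for [b], and the mean value theorem gains a factor
[u] in the error. The equality [size P = K], rather than a bound, records that
the coefficient of order [K - 1] is nonzero. The bound [2^-1] keeps [u] away
from the singularity at [1]. *)
Lemma powR_taylor (R : realType) (K : nat) (b : R) : b < 0 ->
  exists2 P : {poly R}, size P = K &
  exists2 C : R, 0 <= C &
  forall u : R, 0 <= u <= 2^-1 -> `|(1 - u) `^ b - P.[u]| <= C * u ^+ K.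
Proof.
elim: K b => [|K IH] b b0.
  exists 0; first by rewrite size_poly0.
  exists (2^-1 `^ b) => [|u /andP[u0 u1]]; first exact: powR_ge0.
  rewrite horner0 subr0 expr0 mulr1 ger0_norm ?powR_ge0//.
  rewrite -[b]opprK 2![_ `^ (- - b)]powRN.
  rewrite lef_pV2 ?posrE ?powR_gt0//; try lra.
  by apply: ge0_ler_powR; rewrite ?nnegrE; lra.
have [|P sP [C C0 HC]] := IH (b - 1); first by lra.
(* the primitive of [- b *: P] with value 1 at 0 *)
pose Q := \poly_(i < K.+1) if i == 0%N then 1 else - b * P`_i.-1 / i%:R.
have dQ : Q^`() = - b *: P.
  apply/polyP => i; rewrite coef_deriv coef_poly coefZ ltnS.
  case: ltnP => iK /=; last by rewrite mul0rn nth_default ?sP// mulr0.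
  by rewrite -[LHS]mulr_natr divfK// pnatr_eq0.
have Q0 : Q.[0] = 1 by rewrite horner_coef0 coef_poly.
exists Q.
  apply: size_poly_eq; case: K sP {IH HC Q dQ Q0} => [|K] sP /=.
    exact: oner_neq0.
  rewrite !mulf_neq0 ?invr_eq0 ?pnatr_eq0 ?oppr_eq0 ?(lt_eqF b0)//.
  have := lead_coefE P; rewrite sP/= => <-.
  by rewrite lead_coef_eq0 -size_poly_eq0 sP.
exists (- b * C) => [|u /andP[u0 u1]]; first by rewrite mulr_ge0//; lra.
have dh (x : R) : x < 1 -> is_derive x 1 (fun v : R => (1 - v) `^ b - Q.[v])
    (- b * ((1 - x) `^ (b - 1) - P.[x])).
  move=> x1; have dp := is_derive_powR_subr _ b _ x1.
  by apply: is_derive_eq; rewrite dQ hornerZ mulrBr.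
have [||c] := @MVT_segment _ (fun v : R => (1 - v) `^ b - Q.[v])
    (fun v => - b * ((1 - v) `^ (b - 1) - P.[v])) 0 u u0.
- by move=> x; rewrite in_itv/= => /andP[_ xu]; apply: dh; lra.
- apply: derivable_within_continuous => x; rewrite in_itv/= => /andP[_ xu].
  by have [] := dh x ltac:(lra).
rewrite in_itv/= => /andP[c0 cu].
rewrite subr0 powR1 Q0 subrr !subr0 => ->.
rewrite !normrM (ger0_norm u0) (ger0_norm (x := - b)); last by lra.
rewrite exprSr -!mulrA ler_wpM2l//; first by lra.
rewrite mulrA ler_wpM2r// (le_trans (HC c _))//; first by lra.
by rewrite ler_wpM2l// lerXn2r// nnegrE.
Qed.

(** * Vanishing of the moments *)

Lemma integrable_mul_within_continuous (R : realType) (a b : R) (f g : R -> R) :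
  {within `[a, b], continuous f} -> {within `[a, b], continuous g} ->
  (@lebesgue_measure R).-integrable `[a, b] (EFin \o (fun t => f t * g t)).
Proof.
move=> cf cg; apply: continuous_compact_integrable.
  exact: segment_compact.
by move=> t; apply: continuousM; [exact: cf|exact: cg].
Qed.

Lemma within_continuous_powR_subr (R : realType) (b e T : R) :
  0 <= e -> e * T < 1 ->
  {within `[0, T], continuous (fun t : R => (1 - e * t) `^ b)}.
Proof.
move=> e0 eT; apply: derivable_within_continuous => t.
rewrite in_itv/= => /andP[t0 tT].
have et : e * t < 1 by rewrite (le_lt_trans _ eT)// ler_wpM2l.
have d1 : is_derive t 1 (fun t : R => e * t) (e * 1) by exact: is_deriveZ.
by have [] := is_derive1_comp (is_derive_powR_subr _ b _ et) d1.
Qed.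

Lemma le0_of_le_div_nat (R : realType) (x c : R) :
  (forall N, (1 < N)%N -> x <= c / N%:R) -> x <= 0.
Proof.
move=> H; rewrite leNgt; apply/negP => x0.
pose N := (Num.truncn (`|c| / x)).+2.
have xN : x <= `|c| / N%:R.
  by apply: le_trans (H N isT) _; rewrite ler_wpM2r ?invr_ge0// ler_norm.
move: xN; rewrite ler_pdivlMr// => xN.
have : `|c| / x < N%:R.
  by rewrite (lt_le_trans (truncnS_gt _))// ler_nat.
by rewrite ltr_pdivrMr// mulrC ltNge xN.
Qed.

(** The induction hypothesis of [Rintegral_poly_eq0] in usable form: when [g] is
orthogonal to the polynomials of degree less than [K], only the top monomial of
a polynomial of degree [K] contributes. *)
Lemma Rintegral_poly_lead (R : realType) (T : R) (g : R -> R) (K : nat) :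
  {within `[0, T], continuous g} ->
  (forall p : {poly R}, (size p <= K)%N ->
     \int[@lebesgue_measure R]_(t in `[0, T]) (p.[t] * g t) = 0) ->
  forall p : {poly R}, (size p <= K.+1)%N ->
  \int[@lebesgue_measure R]_(t in `[0, T]) (p.[t] * g t) =
  p`_K * \int[@lebesgue_measure R]_(t in `[0, T]) (t ^+ K * g t).
Proof.
move=> cg low p sp.
have ip (q : {poly R}) : (@lebesgue_measure R).-integrable `[0, T]
    (EFin \o (fun t => q.[t] * g t)).
  apply: integrable_mul_within_continuous => //.
  exact/continuous_subspaceT/continuous_horner.
have /low : (size (p - p`_K *: 'X^K)%R <= K)%N.
  apply/leq_sizeP => j; rewrite leq_eqVlt => /predU1P[<-|Kj].
    by rewrite coefB coefZ coefXn eqxx mulr1 subrr.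
  rewrite coefB coefZ coefXn gtn_eqF// mulr0 subr0 nth_default//.
  exact: leq_trans sp Kj.
have iX : (@lebesgue_measure R).-integrable `[0, T]
    (EFin \o (fun t => t ^+ K * g t)).
  rewrite (_ : (fun t => _) = fun t => ('X^K).[t] * g t)//.
  by apply/funext => t; rewrite hornerXn.
under eq_Rintegral do rewrite hornerD hornerN hornerZ hornerXn mulrBl -mulrA.
rewrite RintegralB//; last first.
  rewrite (_ : (fun t => _) = fun t => (p`_K *: 'X^K).[t] * g t)//.
  by apply/funext => t; rewrite hornerZ hornerXn mulrA.
by rewrite RintegralZl// => /eqP; rewrite subr_eq0 => /eqP.
Qed.

(** With e = 1/(N T), the hypothesis allows the Taylor polynomial of (1 - e t)^b
to be replaced by its error term inside the integral. If g is orthogonal to the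
polynomials of degree less than K, this gives
|P_K M| e^K <= C (e T)^(K+1) G, where P_K is the top coefficient of the
polynomial, M the moment of order K and G the integral of |g|. As e T = 1/N,
letting N grow forces M = 0. *)
Lemma Rintegral_poly_eq0 (R : realType) (T b : R) (g : R -> R) :
  0 < T -> b < 0 -> {within `[0, T], continuous g} ->
  (forall N, (1 < N)%N ->
    \int[@lebesgue_measure R]_(t in `[0, T])
      ((1 - (N%:R * T)^-1 * t) `^ b * g t) = 0) ->
  forall p : {poly R},
    \int[@lebesgue_measure R]_(t in `[0, T]) (p.[t] * g t) = 0.
Proof.
move=> T0 b0 cg H.
suff low K : forall p : {poly R}, (size p <= K)%N ->
    \int[@lebesgue_measure R]_(t in `[0, T]) (p.[t] * g t) = 0.
  by move=> p; exact: low.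
elim: K => [p|K IH p sp].
  rewrite leqn0 size_poly_eq0 => /eqP ->.
  under eq_Rintegral do rewrite horner0 mul0r.
  by rewrite Rintegral_cst// mul0r.
have lead := Rintegral_poly_lead R T g K cg IH.
rewrite lead//.
set M := \int[_]_(t in _) _.
have [P sP [C C0 HC]] := powR_taylor R K.+1 b b0.
have PK : P`_K != 0.
  have := lead_coefE P; rewrite sP/= => <-.
  by rewrite lead_coef_eq0 -size_poly_eq0 sP.
pose G := \int[@lebesgue_measure R]_(t in `[0, T]) `|g t|.
suff : `|P`_K * M| / T ^+ K <= 0.
  rewrite pmulr_lle0 ?invr_gt0 ?exprn_gt0// normr_le0 mulf_eq0 (negbTE PK)/=.
  by move=> /eqP ->; rewrite mulr0.
apply: (@le0_of_le_div_nat _ _ (C * G)) => N N1.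
have N0 : 0 < N%:R :> R by rewrite ltr0n ltnW.
pose e := (N%:R * T)^-1.
have e0 : 0 < e by rewrite invr_gt0 mulr_gt0.
have eT : e * T = N%:R^-1 by rewrite /e invfM divfK ?gt_eqF.
(* puts [e * t] in the range of validity of the Taylor expansion *)
have N2 : N%:R^-1 <= 2^-1 :> R by rewrite lef_pV2 ?posrE// ler_nat.
pose q := \poly_(i < K.+1) (P`_i * e ^+ i).
have qE t : q.[t] = P.[e * t].
  rewrite horner_poly horner_coef sP; apply: eq_bigr => i _.
  by rewrite exprMn mulrA.
have := lead q (size_poly _ _); rewrite coef_poly ltnS leqnn -/M => qM.
have ck : {within `[0, T], continuous (fun t : R => (1 - e * t) `^ b)}.
  by apply: within_continuous_powR_subr; [exact: ltW|rewrite eT; lra].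
have cq : {within `[0, T], continuous (fun t => q.[t])}.
  exact/continuous_subspaceT/continuous_horner.
have cng : {within `[0, T], continuous (fun t => `|g t|)}.
  by move=> t; apply: continuous_comp; [exact: cg|exact: norm_continuous].
have ik := integrable_mul_within_continuous _ _ _ _ _ ck cg.
have iq := integrable_mul_within_continuous _ _ _ _ _ cq cg.
have ikq : (@lebesgue_measure R).-integrable `[0, T]
    (EFin \o (fun t => (q.[t] - (1 - e * t) `^ b) * g t)).
  apply: integrable_mul_within_continuous => // t.
  by apply: continuousB; [exact: cq|exact: ck].
have icg c : (@lebesgue_measure R).-integrable `[0, T]
    (EFin \o (fun t => c * `|g t|)).
  apply: integrable_mul_within_continuous => //.
  by apply: continuous_subspaceT; exact: cst_continuous.
have ing : (@lebesgue_measure R).-integrable `[0, T] (EFin \o (fun t => `|g t|)).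
  by apply: continuous_compact_integrable => //; exact: segment_compact.
have bound : `|P`_K * e ^+ K * M| <= C * N%:R^-1 ^+ K.+1 * G.
  have -> : P`_K * e ^+ K * M = \int[@lebesgue_measure R]_(t in `[0, T])
      ((q.[t] - (1 - e * t) `^ b) * g t).
    under eq_Rintegral do rewrite mulrBl.
    by rewrite RintegralB// H// subr0.
  rewrite (le_trans (le_normr_Rintegral _ _))// /G -RintegralZl//.
  apply: le_Rintegral => //.
    exact: integrable_abse ikq.
  move=> t /=; rewrite in_itv/= => /andP[t0 tT].
  have et0 : 0 <= e * t by rewrite mulr_ge0// ltW.
  have etN : e * t <= N%:R^-1 by rewrite -eT ler_wpM2l// ltW.
  rewrite normrM ler_wpM2r// qE distrC (le_trans (HC _ _)) ?et0 ?(le_trans etN)//.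
  by rewrite ler_wpM2l// lerXn2r// nnegrE invr_ge0.
rewrite -(ler_pM2l (x := N%:R^-1 ^+ K)) ?exprn_gt0 ?invr_gt0//.
move: bound; rewrite mulrAC normrM (ger0_norm (x := _ ^+ K)); last first.
  by rewrite exprn_ge0// ltW.
rewrite /e invfM exprMn exprS -[(T ^+ K)^-1]exprVn => bound.
rewrite mulrCA [leRHS](_ : _ = C * (N%:R^-1 * N%:R^-1 ^+ K) * G)//.
by ring.
Qed.

(** * Reduction to the first period *)

Lemma continuous_half_line_itv (R : realType) (f : R -> R) (T : R) :
  continuous_half_line f -> {within `[0, T], continuous f}.
Proof.
move=> cf; apply: continuous_subspaceW cf => t /=.
by rewrite !in_itv/= => /andP[->].
Qed.

(** The integral from T to (p + 1) T equals the one given to vanish for p, by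
translation and periodicity. *)
Lemma integral_powR_first_period (R : realType) (T b : R) (g : R -> R)
    (p : nat) :
  0 < T -> continuous_half_line g -> periodic_half_line T g ->
  (\int[@lebesgue_measure R]_(t in [set` `[0, p%:R * T]%R])
     ((p%:R * T - t) `^ b * g t)%:E = 0)%E ->
  (\int[@lebesgue_measure R]_(t in [set` `[0, (p.+1)%:R * T]%R])
     (((p.+1)%:R * T - t) `^ b * g t)%:E = 0)%E ->
  (\int[@lebesgue_measure R]_(t in [set` `[0, T]%R])
     (((p.+1)%:R * T - t) `^ b * g t)%:E = 0)%E.
Proof.
move=> T0 cg pg Ip IS.
pose F t := ((p.+1%:R * T - t) `^ b * g t)%:E.
have pT : p.+1%:R * T = p%:R * T + T by rewrite -natr1 mulrDl mul1r.
have mF : measurable_fun `[0, p.+1%:R * T] F.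
  apply/measurable_EFinP/measurable_funM.
    apply: (measurableT_comp (measurable_powR b)).
    by apply: measurable_funB => //; exact: measurable_cst.
  apply: subspace_continuous_measurable_fun => //.
  exact: continuous_half_line_itv.
have TpT : T <= p.+1%:R * T by rewrite pT lerDr mulr_ge0// ltW.
have mF1 : measurable_fun `[0, T[ F.
  apply: measurable_funS mF => // t /=; rewrite !in_itv/= => /andP[-> /ltW tT].
  exact: le_trans TpT.
have mF2 : measurable_fun `[T, p.+1%:R * T] F.
  apply: measurable_funS mF => // t /=; rewrite !in_itv/= => /andP[tT ->].
  by rewrite (le_trans _ tT)// ltW.
have tail : (\int[@lebesgue_measure R]_(t in [set` `[T, p.+1%:R * T]%R]) F t = 0)%E.
  rewrite (integral_translation _ T)// -Ip.
  have -> : (fun x => x + T) @^-1` `[T, p.+1%:R * T] = `[0, p%:R * T]%classic.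
    by apply/seteqP; split => t /=; rewrite !in_itv/= pT lerD2r -lerBlDr subrr.
  apply: eq_integral => t; rewrite inE/= in_itv/= => /andP[t0 _].
  by rewrite /F pg// pT; congr (_ `^ _ * _)%:E; ring.
rewrite -(integral_itv_bndo_bndc mF1) -[RHS]IS.
rewrite -[LHS]adde0 -[X in (_ + X)%E]tail -integral_setU//.
- by rewrite -itv_bndbnd_setU// bnd_simp// ltW.
- by rewrite -itv_bndbnd_setU// bnd_simp// ltW.
- apply/disj_setPS => t [/=]; rewrite !in_itv/= => /andP[_ tT] /andP[].
  by rewrite leNgt tT.
Qed.

(** * The theorem *)

Theorem mainTheorem1 (R : realType) (n : nat) (hn : (0 < n)%N)
  (T : R) (hT : 0 < T)
  (alpha : 'I_n -> R) (halpha : forall i : 'I_n, 0 < alpha i < 1)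
  (g : 'I_n -> R -> R)
  (hcont : forall i : 'I_n, continuous_half_line (g i))
  (hper : forall i : 'I_n, periodic_half_line T (g i))
  (hint : forall (p : nat) (i : 'I_n), (0 < p)%N ->
     (\int[@lebesgue_measure R]_(tau in [set` `[0, p%:R * T]%R])
        ((p%:R * T - tau) `^ (alpha i - 1) * g i tau)%:E = 0)%E) :
  forall (m : nat) (i : 'I_n), (0 < m)%N ->
    (\int[@lebesgue_measure R]_(tau in [set` `[0, T]%R])
       (tau ^+ m * g i tau)%:E = 0)%E.
Proof.
move=> m i _.
have /andP[_ a1] := halpha i.
set b := alpha i - 1 in hint *.
have b0 : b < 0 by rewrite subr_lt0.
have cg : {within `[0, T], continuous (g i)}.
  exact: continuous_half_line_itv.
have iX : (@lebesgue_measure R).-integrable `[0, T]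
    (EFin \o (fun t => t ^+ m * g i t)).
  apply: integrable_mul_within_continuous => //.
  by apply: continuous_subspaceT; exact: exprn_continuous.
rewrite -[LHS]fineK; last exact: integrable_fin_num iX.
congr EFin.
suff /(_ 'X^m) : forall p : {poly R},
    \int[@lebesgue_measure R]_(t in `[0, T]) (p.[t] * g i t) = 0.
  by under eq_Rintegral do rewrite hornerXn.
apply: (@Rintegral_poly_eq0 _ _ b) => // -[|p]// p0.
(* the factor [(N T) ^ b] is put back, with [N = p.+1] *)
have first_period := @integral_powR_first_period _ T b (g i) p hT (hcont i)
  (hper i) (hint p i p0) (hint p.+1 i isT).
have NT : 0 < p.+1%:R * T by rewrite mulr_gt0.
have c0 : (p.+1%:R * T) `^ b != 0 by rewrite gt_eqF ?powR_gt0.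
apply: (mulfI c0); rewrite mulr0 -RintegralZl//; last first.
  apply: integrable_mul_within_continuous => //.
  apply: within_continuous_powR_subr; first by rewrite invr_ge0 ltW.
  by rewrite invfM divfK ?gt_eqF// invf_lt1// ltr1n.
rewrite -[RHS](congr1 fine first_period).
apply: eq_Rintegral => t; rewrite inE/= in_itv/= => /andP[t0 tT].
rewrite mulrA -powRM.
- by rewrite mulrBr mulr1 mulrA divff ?mul1r ?gt_eqF.
- exact: ltW.
- rewrite subr_ge0 mulrC ler_pdivrMr// mul1r (le_trans tT)//.
  by rewrite ler_peMl ?ler1n// ltW.
Qed.
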